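(* The set $\mathcal{B}$ of monomials \[ \prod_{a=1}^n \psi_a^{p_a}(\psi_a^* )^{d_a}\omega_a^{v_a}\qquad(\text{factors taken in the order } a=1,2,\dots,n), \] where $p_a,d_a\in\{0,1\}$ and $v_a\in\{0,1,\dots,2k-1\}$ for each $a$, is a $\mathbb{k}$-basis of $\mathrm{Cl}_q(n,k)$.
   Context: Let $\mathbb{k}$ be a field of characteristic different from $2$, let $q\in\mathbb{k}^\times$, and let $n,k$ be positive integers. The quantum Clifford algebra $\mathrm{Cl}_q(n,k)$ is the unital associative $\mathbb{k}$-algebra generated by $\psi_a,\psi_a^*,\omega_a,\omega_a^{-1}$ for $a\in\{1,\dots,n\}$, subject to the relations (for all $a,b\in\{1,\dots,n\}$): $\omega_a\omega_b=\omega_b\omega_a$; $\omega_a\omega_a^{-1}=1$; $\omega_a\psi_b=q^{\delta_{ab}}\psi_b\omega_a$; $\omega_a\psi_b^*=q^{-\delta_{ab}}\psi_b^*\omega_a$; $\psi_a\psi_b+\psi_b\psi_a=0$; $\psi_a^*\psi_b^*+\psi_b^*\psi_a^*=0$; $\psi_a\psi_a^*+q^k\psi_a^*\psi_a=\omega_a^{-k}$; $\psi_a\psi_a^*+q^{-k}\psi_a^*\psi_a=\omega_a^{k}$; and $\psi_a\psi_b^*+\psi_b^*\psi_a=0$ if $a\neq b$. *)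

(* Defs.v *)
From HB Require Import structures.
From mathcomp Require Import all_boot all_order all_algebra.
From mathcomp Require Import finmap.
From mathcomp.multinomials Require Import monalg.
Set Implicit Arguments. Unset Strict Implicit. Unset Printing Implicit Defensive.
Import GRing.Theory.
Local Open Scope ring_scope.

Definition gen (n : nat) : Type := ('I_n + 'I_n + 'I_n + 'I_n)%type.
Definition Lpsi  n (a : 'I_n) : gen n := inl (inl (inl a)).
Definition Lpsis n (a : 'I_n) : gen n := inl (inl (inr a)).
Definition Lom   n (a : 'I_n) : gen n := inl (inr a).
Definition Lomi  n (a : 'I_n) : gen n := inr a.

Definition word (n : nat) : Type := seq (gen n).
HB.instance Definition _ n := Choice.on (word n).

Lemma word_mulA n : associative (@cat (gen n)). Proof. exact: catA. Qed.
Lemma word_mul1 n : left_id (@nil (gen n)) (@cat (gen n)). Proof. by []. Qed.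
Lemma word_mulr1 n : right_id (@nil (gen n)) (@cat (gen n)). Proof. exact: cats0. Qed.
Lemma word_unit n (x y : seq (gen n)) : x ++ y = [::] -> x = [::] /\ y = [::].
Proof. by case: x => [|? ?] //; case: y. Qed.

HB.instance Definition _ n := Choice_isMonomialDef.Build (word n)
  (@word_mulA n) (@word_mul1 n) (@word_mulr1 n) (@word_unit n).

Definition FA (K : fieldType) (n : nat) := {malg K[word n]}.

Definition X (K : fieldType) n (x : gen n) : FA K n := << ([:: x] : word n) >>.
Definition Psi  K n a := @X K n (Lpsi a).
Definition PsiS K n a := @X K n (Lpsis a).
Definition Om   K n a := @X K n (Lom a).
Definition OmI  K n a := @X K n (Lomi a).

Definition cl_rel (K : fieldType) (q : K) (n k : nat) (x : FA K n) : Prop :=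
  (exists a b : 'I_n, x = Om K a * Om K b - Om K b * Om K a) \/
      (exists a : 'I_n, x = Om K a * OmI K a - 1) \/
      (exists a : 'I_n, x = OmI K a * Om K a - 1) \/
      (exists a b : 'I_n,
         x = Om K a * Psi K b - (if a == b then q else 1) *: (Psi K b * Om K a)) \/
      (exists a b : 'I_n,
         x = Om K a * PsiS K b - (if a == b then q^-1 else 1) *: (PsiS K b * Om K a)) \/
      (exists a b : 'I_n, x = Psi K a * Psi K b + Psi K b * Psi K a) \/
      (exists a b : 'I_n, x = PsiS K a * PsiS K b + PsiS K b * PsiS K a) \/
      (exists a : 'I_n,
         x = Psi K a * PsiS K a + q ^+ k *: (PsiS K a * Psi K a) - OmI K a ^+ k) \/
      (exists a : 'I_n,
         x = Psi K a * PsiS K a + q ^- k *: (PsiS K a * Psi K a) - Om K a ^+ k) \/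
      (exists a b : 'I_n, a != b /\ x = Psi K a * PsiS K b + PsiS K b * Psi K a).

Inductive in_ideal (R : ringType) (S : R -> Prop) : R -> Prop :=
  | ideal0 : in_ideal S 0
  | idealS s l r : S s -> in_ideal S (l * s * r)
  | idealD x y : in_ideal S x -> in_ideal S y -> in_ideal S (x + y).

(* Cl_q(n,k) = FA / I; "f = g in Cl_q(n,k)" is f - g \in I. *)
Definition cl_ideal (K : fieldType) (q : K) (n k : nat) : FA K n -> Prop :=
  in_ideal (@cl_rel K q n k).

Definition clidx (n k : nat) := {ffun 'I_n -> bool * bool * 'I_(k.*2)}.

Definition clmon (K : fieldType) (n k : nat) (m : clidx n k) : FA K n :=
  \prod_(a < n) (Psi K a ^+ (m a).1.1 * PsiS K a ^+ (m a).1.2 * Om K a ^+ (m a).2).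

(* Main.v *)
Require Import Defs.
From HB Require Import structures.
From mathcomp Require Import all_boot all_order all_algebra.
From mathcomp Require Import finmap.
From mathcomp.multinomials Require Import monalg.
From Stdlib Require Import Setoid Morphisms.
Import GRing.Theory.
Set Implicit Arguments. Unset Strict Implicit. Unset Printing Implicit Defensive.
Local Open Scope ring_scope.

(** Spanning: write [P], [D], [W] for [psi_a], [psi_a^*], [omega_a]. Eliminating
    [D P] between the two mixed relations gives
    [W^(2k) = T + q^(-2k) (1 - T)] with [T = P D W^k], hence [P W^(2k) = q^(-2k) P],
    [D W^(2k) = D], and [W^-1] is a polynomial in [P], [D], [W]. So the span of the
    monomials is stable under left multiplication by every generator.

    Independence: the algebra acts on functions on [(bool * Z/2k)^n]; in one mode
    this is the identification with 2x2 matrices over [K[t]/(t^(2k) - 1)] given by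
    [psi = E_10], [psi^* = t^k E_01], [omega = t diag(q^-1, 1)], and the modes are
    combined with Jordan-Wigner signs. Each monomial acts as a partial permutation
    of the states up to nonzero scalars. A monomial [m] applied at the state
    [(p_a, 0)_a] shares its target only with monomials obtained from [m] by replacing
    some factors [psi_a psi_a^*] by [1], so induction on the number of factors
    [psi_a psi_a^*] shows that all coefficients vanish. *)

(** * Congruence modulo a two-sided ideal *)

Section IdealCongruence.
Context {K : fieldType} {A : algType K}.
Variable S : A -> Prop.

Lemma in_idealMl x y : in_ideal S y -> in_ideal S (x * y).
Proof.
elim=> [|s l r Ss|u v _ IHu _ IHv]; first by rewrite mulr0; constructor.
- by rewrite !mulrA; constructor.
- by rewrite mulrDr; constructor.
Qed.

Lemma in_idealMr x y : in_ideal S y -> in_ideal S (y * x).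
Proof.
elim=> [|s l r Ss|u v _ IHu _ IHv]; first by rewrite mul0r; constructor.
- by rewrite -mulrA; constructor.
- by rewrite mulrDl; constructor.
Qed.

Lemma in_idealZ (c : K) y : in_ideal S y -> in_ideal S (c *: y).
Proof. by rewrite -mulr_algl; apply: in_idealMl. Qed.

Lemma in_idealN y : in_ideal S y -> in_ideal S (- y).
Proof. by rewrite -mulN1r; apply: in_idealMl. Qed.

Lemma in_ideal_rel x : S x -> in_ideal S x.
Proof. by move=> Sx; rewrite -[x]mulr1 -[x]mul1r; constructor. Qed.

(** Equality in the quotient by the ideal. The quotient itself is not formed; the instances below
    allow rewriting with the congruence. *)
Definition cong (x y : A) : Prop := in_ideal S (x - y).

Lemma cong_refl x : cong x x.
Proof. by rewrite /cong subrr; constructor. Qed.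

#[local] Hint Resolve cong_refl : core.

Lemma cong_sym x y : cong x y -> cong y x.
Proof. by rewrite /cong -(opprB x y); apply: in_idealN. Qed.

Lemma cong_trans x y z : cong x y -> cong y z -> cong x z.
Proof. by rewrite /cong -[x - z](subrKA y); apply: idealD. Qed.

#[local] Instance cong_equiv : Equivalence cong.
Proof. split; [exact: cong_refl|exact: cong_sym|exact: cong_trans]. Qed.

#[local] Instance cong_add : Proper (cong ==> cong ==> cong) (@GRing.add A).
Proof. by move=> x y xy z t zt; rewrite /cong opprD addrACA; apply: idealD. Qed.

#[local] Instance cong_opp : Proper (cong ==> cong) (@GRing.opp A).
Proof. by move=> x y xy; rewrite /cong -opprD; apply: in_idealN. Qed.

#[local] Instance cong_mul : Proper (cong ==> cong ==> cong) (@GRing.mul A).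
Proof.
move=> x y xy z t zt; apply: (@cong_trans _ (y * z)).
  by rewrite /cong -mulrBl; apply: in_idealMr.
by rewrite /cong -mulrBr; apply: in_idealMl.
Qed.

#[local] Instance cong_scale : Proper (eq ==> cong ==> cong) (@GRing.scale K A).
Proof. by move=> c _ <- x y xy; rewrite /cong -scalerBr; apply: in_idealZ. Qed.

Lemma cong0 x : cong x 0 <-> in_ideal S x.
Proof. by rewrite /cong subr0. Qed.

Lemma cong_sub0 x y : cong (x - y) 0 <-> cong x y.
Proof. by rewrite cong0. Qed.

Lemma cong_relB x y : S (x - y) -> cong x y.
Proof. exact: in_ideal_rel. Qed.

Lemma cong_relD x y : S (x + y) -> cong x (- y).
Proof. by move=> Sxy; apply: cong_relB; rewrite opprK. Qed.

Lemma cong_scaleI (c : K) x y : c != 0 -> cong (c *: x) (c *: y) -> cong x y.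
Proof.
by move=> c0 /(cong_scale (erefl c^-1)); rewrite !scalerA mulVf // !scale1r.
Qed.

(** * Spans of finite families modulo the ideal *)

Section Span.
Context {T : finType}.
Implicit Type e : T -> A.

Definition spanned e (x : A) : Prop :=
  exists c : T -> K, cong x (\sum_t c t *: e t).

#[local] Instance spanned_cong : Proper (eq ==> cong ==> iff) spanned.
Proof.
move=> e _ <- x y xy; split=> -[c xc]; exists c; first by rewrite -xy.
by rewrite xy.
Qed.

Lemma spanned0 e : spanned e 0.
Proof. by exists (fun=> 0); rewrite big1 // => t _; rewrite scale0r. Qed.

Lemma spannedD e x y : spanned e x -> spanned e y -> spanned e (x + y).
Proof.
move=> [c xc] [d yd]; exists (fun t => c t + d t).
by under eq_bigr do rewrite scalerDl; rewrite big_split /= -xc -yd.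
Qed.

Lemma spannedZ e (a : K) x : spanned e x -> spanned e (a *: x).
Proof.
move=> [c xc]; exists (fun t => a * c t).
by under eq_bigr do rewrite -scalerA; rewrite -scaler_sumr -xc.
Qed.

Lemma spannedB e x y : spanned e x -> spanned e y -> spanned e (x - y).
Proof. by move=> ex ey; rewrite -scaleN1r; apply/spannedD/spannedZ. Qed.

Lemma spanned_gen e t : spanned e (e t).
Proof.
exists (fun u => (u == t)%:R); rewrite (bigD1 t) //= eqxx scale1r big1 ?addr0 //.
by move=> u /negPf ->; rewrite scale0r.
Qed.

Lemma spanned_sum e (I : Type) (r : seq I) (F : I -> A) :
  (forall i, spanned e (F i)) -> spanned e (\sum_(i <- r) F i).
Proof.
move=> eF; elim: r => [|i r IH]; first by rewrite big_nil; apply: spanned0.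
by rewrite big_cons; apply: spannedD.
Qed.

End Span.

#[local] Existing Instance spanned_cong.

(** By linearity it suffices to test the spanning family; used below for left and for right
    multiplications. *)
Lemma spanned_map (T U : finType) (e : T -> A) (f : U -> A) (phi : A -> A) x :
  Proper (cong ==> cong) phi -> {morph phi : u v / u + v} ->
  (forall c, {morph phi : u / c *: u}) -> (forall t, spanned f (phi (e t))) ->
  spanned e x -> spanned f (phi x).
Proof.
move=> phi_cong phiD phiZ ef [c xc].
apply/(spanned_cong (erefl f) (phi_cong _ _ xc)).
rewrite (big_morph phi phiD (_ : phi 0 = 0)); last first.
  by rewrite -[X in phi X](scale0r 0) phiZ scale0r.
by apply: spanned_sum => t; rewrite phiZ; apply: spannedZ.
Qed.

(** * One mode: reduction of exponents and stability of the span *)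

Section OneMode.
Variables (q : K) (k : nat) (P D W V : A).
Hypothesis q0 : q != 0.
Hypothesis k0 : (0 < k)%N.
Hypothesis WV : cong (W * V) 1.
Hypothesis VW : cong (V * W) 1.
Hypothesis WP : cong (W * P) (q *: (P * W)).
Hypothesis WD : cong (W * D) (q^-1 *: (D * W)).
Hypothesis PP : cong (P * P) 0.
Hypothesis DD : cong (D * D) 0.
Hypothesis PDV : cong (P * D + q ^+ k *: (D * P)) (V ^+ k).
Hypothesis PDW : cong (P * D + q ^- k *: (D * P)) (W ^+ k).

Let Q0 : q ^+ k != 0. Proof. by rewrite expf_neq0. Qed.

Lemma omX_invX v : cong (V ^+ v * W ^+ v) 1.
Proof.
elim: v => [|v IH]; first by rewrite mulr1.
by rewrite exprSr exprS mulrA -[V ^+ v * V * W]mulrA VW mulr1.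
Qed.

Lemma omX_psis v : cong (W ^+ v * D) (q ^- v *: (D * W ^+ v)).
Proof.
elim: v => [|v IH]; first by rewrite !expr0 invr1 scale1r mul1r mulr1.
rewrite exprSr -mulrA WD -scalerAr [W ^+ v * (D * W)]mulrA IH -scalerAl scalerA.
by rewrite -mulrA exprSr invfM mulrC.
Qed.

Lemma psis_psi : cong (D * P) (q ^+ k *: (W ^+ k - P * D)).
Proof.
by rewrite -PDW [_ + _ - _]addrC addKr scalerA mulfV // scale1r.
Qed.

(** In the matrix picture, the projection [E_11] onto the occupied state. *)
Let T := P * D * W ^+ k.

(** Solving each mixed relation for [D P] and equating gives [W^k - P D = q^(-2k) (V^k - P D)];
    right multiplication by [W^k] turns [V^k] into 1 and [P D] into [T]. *)
Lemma om2k : cong (W ^+ k.*2) (T + (q ^+ k.*2)^-1 *: (1 - T)).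
Proof.
have DPV : cong (D * P) (q ^- k *: (V ^+ k - P * D)).
  by rewrite -PDV [_ + _ - _]addrC addKr scalerA mulVf // scale1r.
have E : cong (W ^+ k - P * D) ((q ^+ k.*2)^-1 *: (V ^+ k - P * D)).
  apply: (cong_scaleI Q0); rewrite -psis_psi DPV scalerA -addnn exprD invfM.
  by rewrite mulrA mulfV // mul1r.
have -> : W ^+ k.*2 = T + (W ^+ k - P * D) * W ^+ k.
  by rewrite mulrBl -exprD addnn addrC subrK.
by rewrite E -scalerAl mulrBl omX_invX.
Qed.

Lemma psi_om2k : cong (P * W ^+ k.*2) ((q ^+ k.*2)^-1 *: P).
Proof.
have PT : cong (P * T) 0 by rewrite /T !mulrA PP !mul0r.
by rewrite om2k mulrDr -scalerAr mulrBr PT mulr1 add0r subr0.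
Qed.

(** Reordering [D P] in [D T] kills the term with [D D] and gives [D T = D W^(2k)]. The formula for
    [W^(2k)] then leaves [q^(-2k) (D - D W^(2k)) = 0], so only [q] is inverted and [q^(2k) = 1] is
    allowed. *)
Lemma psis_om2k : cong (D * W ^+ k.*2) D.
Proof.
have DT : cong (D * T) (D * W ^+ k.*2).
  rewrite /T !mulrA psis_psi -scalerAl mulrBl -[P * D * D]mulrA DD mulr0 subr0.
  by rewrite omX_psis scalerA mulfV // scale1r -mulrA -exprD addnn.
have E : cong (D * W ^+ k.*2) (D * T + (q ^+ k.*2)^-1 *: (D - D * T)).
  by rewrite om2k mulrDr -scalerAr mulrBr mulr1.
rewrite DT in E.
have {}E : cong ((q ^+ k.*2)^-1 *: (D - D * W ^+ k.*2)) ((q ^+ k.*2)^-1 *: 0).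
  by rewrite -[X in cong X](addKr (D * W ^+ k.*2)) -E addNr scaler0.
symmetry; apply/cong_sub0/(cong_scaleI _ E).
by rewrite invr_eq0 expf_neq0.
Qed.

(** Right multiplication of the formula for [W^(2k)] by [V] gives
    [W^(2k-1) = T V + q^(-2k) (V - T V)] with [T V = P D W^(k-1)], which is solved for [V]. *)
Lemma om_inv : cong V (P * D * W ^+ k.-1 +
  q ^+ k.*2 *: (W ^+ k.*2.-1 - P * D * W ^+ k.-1)).
Proof.
have XV j : (0 < j)%N -> cong (W ^+ j * V) (W ^+ j.-1).
  by case: j => // j _; rewrite exprSr -mulrA WV mulr1.
have TV : cong (T * V) (P * D * W ^+ k.-1) by rewrite /T -mulrA XV.
rewrite -(XV k.*2) ?double_gt0 // om2k -TV mulrDl [_ + _ - _]addrC addKr.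
by rewrite -scalerAl scalerA mulfV ?expf_neq0 // scale1r mulrBl mul1r addrC subrK.
Qed.

Definition mode_monomial (p d : bool) (v : nat) : A := P ^+ p * D ^+ d * W ^+ v.

Lemma om_mode_monomial p d v :
  exists c, cong (W * mode_monomial p d v) (c *: mode_monomial p d v.+1).
Proof.
have WPp : cong (W * P ^+ p) (q ^+ p *: (P ^+ p * W)).
  by case: p; rewrite ?expr0 ?scale1r ?mulr1 ?mul1r.
have WDd : cong (W * D ^+ d) (q ^- d *: (D ^+ d * W)).
  by case: d; rewrite ?expr0 ?invr1 ?scale1r ?mulr1 ?mul1r.
exists (q ^+ p * q ^- d); rewrite /mode_monomial !mulrA WPp -!scalerAl.
rewrite -[P ^+ p * W * _]mulrA WDd -scalerAr -scalerAl scalerA !mulrA.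
by rewrite exprS !mulrA.
Qed.

Definition mode_basis (z : bool * bool * 'I_(k.*2)) : A :=
  mode_monomial z.1.1 z.1.2 z.2.

Lemma mode_basisE p d v : mode_basis (p, d, v) = P ^+ p * D ^+ d * W ^+ v.
Proof. by []. Qed.

(** Strong induction on [v]: a factor [W^(2k)] is absorbed by [D], becomes a scalar next to [P]
    alone, and otherwise yields exponents [u = v - 2k] and [k + u], the latter with [P D] in
    front. *)
Lemma spanned_mode_monomial p d v : spanned mode_basis (mode_monomial p d v).
Proof.
elim/ltn_ind: v p d => v IH p d.
have [v2k|v2k] := ltnP v k.*2; first exact: (spanned_gen _ (p, d, Ordinal v2k)).
have k20 : (0 < k.*2)%N by rewrite double_gt0.
rewrite -(subnKC v2k); set u := (v - k.*2)%N.
have uv : (u < v)%N by rewrite /u ltn_subrL k20 (leq_trans k20).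
have kuv : (k + u < v)%N.
  by rewrite -(subnKC v2k) -/u ltn_add2r -addnn -{1}[k]addn0 ltn_add2l.
have IHu := IH u uv.
rewrite /mode_monomial exprD; case: d; last first.
  rewrite expr0 mulr1; case: p.
    rewrite mulrA psi_om2k -scalerAl; apply: spannedZ.
    by have := IHu true false; rewrite /mode_monomial mulr1.
  rewrite mul1r om2k mulrDl -scalerAl mulrBl mul1r.
  have X11 : spanned mode_basis (P * D * W ^+ k * W ^+ u).
    by rewrite -mulrA -exprD; apply: (IH _ kuv true true).
  apply/spannedD/spannedZ/spannedB => //.
  by have := IHu false false; rewrite /mode_monomial !mul1r.
rewrite mulrA -[P ^+ p * _ * _]mulrA psis_om2k; exact: (IHu p true).
Qed.

Lemma om_mode_basis z : spanned mode_basis (W * mode_basis z).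
Proof.
have [c ->] := om_mode_monomial z.1.1 z.1.2 z.2.
exact/spannedZ/spanned_mode_monomial.
Qed.

Lemma psi_mode_basis z : spanned mode_basis (P * mode_basis z).
Proof.
case: z => [[[] d] v]; rewrite mode_basisE !mulrA.
  by rewrite PP !mul0r; apply: spanned0.
by rewrite mulr1; apply: (spanned_mode_monomial true d v).
Qed.

Lemma psis_mode_basis z : spanned mode_basis (D * mode_basis z).
Proof.
case: z => [[[] d] v]; rewrite mode_basisE !mulrA; last first.
  rewrite mulr1; case: d; first by rewrite DD mul0r; apply: spanned0.
  rewrite mulr1 -[D]mul1r; exact: (spanned_mode_monomial false true v).
(* [D P] is reordered; if another [D] follows, only [W^k D] survives, which is put in normal order
   up to a power of [q]. *)
rewrite psis_psi -!scalerAl; apply: spannedZ; case: d.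
  rewrite mulrBl -[P * D * D]mulrA DD mulr0 subr0 omX_psis -scalerAl.
  apply: spannedZ; rewrite -mulrA -exprD -[D]mul1r.
  exact: (spanned_mode_monomial false true).
rewrite mulr1 mulrBl -exprD; apply: spannedB.
  2: exact: (spanned_mode_monomial true true).
by have := spanned_mode_monomial false false (k + v); rewrite /mode_monomial !mul1r.
Qed.

End OneMode.

Arguments mode_basis k P D W z : clear implicits.

(** * Commutation up to scalars and several modes *)

Definition quasi_comm x y : Prop := exists c : K, cong (x * y) (c *: (y * x)).

Lemma quasi_commM x y z :
  quasi_comm x y -> quasi_comm x z -> quasi_comm x (y * z).
Proof.
move=> [c xy] [d xz]; exists (c * d).
by rewrite mulrA xy -scalerAl -[y * x * z]mulrA xz -scalerAr scalerA mulrA.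
Qed.

Lemma quasi_commX x y j : quasi_comm x y -> quasi_comm x (y ^+ j).
Proof.
move=> xy; elim: j => [|j IH]; last by rewrite exprS; apply: quasi_commM.
by exists 1; rewrite scale1r mulr1 mul1r.
Qed.

Lemma quasi_comm_cong x y : cong (x * y) (y * x) -> quasi_comm x y.
Proof. by exists 1; rewrite scale1r. Qed.

Lemma quasi_commC_cong x y : cong (y * x) (x * y) -> quasi_comm x y.
Proof. by move/cong_sym; apply: quasi_comm_cong. Qed.

Lemma quasi_comm_congN x y : cong (x * y) (- (y * x)) -> quasi_comm x y.
Proof. by exists (- 1); rewrite scaleN1r. Qed.

Lemma quasi_commC_congN x y : cong (y * x) (- (x * y)) -> quasi_comm x y.
Proof. by move=> yx; apply: quasi_comm_congN; rewrite yx opprK. Qed.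

Section Modes.
Variables (n k : nat) (P D W : 'I_n -> A).
Implicit Types (m : clidx n k) (a b : 'I_n).

Let M b := mode_basis k (P b) (D b) (W b).
Let basis (l : seq 'I_n) m := \prod_(b <- l) M b (m b).

Definition set_mode m a z : clidx n k := [ffun b => if b == a then z else m b].

Lemma quasi_comm_mode_basis x b z :
  quasi_comm x (P b) -> quasi_comm x (D b) -> quasi_comm x (W b) ->
  quasi_comm x (M b z).
Proof.
by move=> xP xD xW; do 2?apply: quasi_commM; apply: quasi_commX.
Qed.

Lemma basis_cons_set_mode l m b z : b \notin l ->
  basis (b :: l) (set_mode m b z) = M b z * basis l m.
Proof.
move=> bl; rewrite /basis big_cons ffunE eqxx; congr (_ * _).
apply: eq_big_seq => c cl; rewrite ffunE; case: eqP => // cb.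
by rewrite -cb cl in bl.
Qed.

(** Induction on the modes: [x] passes the factors before mode [a] at the cost of scalars and then
    acts on the factor of mode [a], which can change alone since the modes are distinct. *)
Lemma spanned_mul_basis a x l m :
  (forall b z, b != a -> quasi_comm x (M b z)) ->
  (forall z, spanned (M a) (x * M a z)) ->
  uniq l -> a \in l -> spanned (basis l) (x * basis l m).
Proof.
move=> xC xM; elim: l m => // b l IH m /= /andP[bl ul].
have [ba _|ab /= al] := eqVneq b a.
  subst b; rewrite {2}/basis big_cons mulrA -/(basis l m).
  apply: (@spanned_map _ _ (M a) _ (fun y => y * basis l m)).
  - by move=> y z ->.
  - by move=> y z; rewrite mulrDl.
  - by move=> c y; rewrite scalerAl.
  - by move=> z; rewrite -basis_cons_set_mode //; apply: spanned_gen.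
  - exact: xM.
rewrite {2}/basis big_cons -/(basis l m) mulrA.
have [c ->] := xC b (m b) ab; rewrite -scalerAl -mulrA; apply: spannedZ.
apply: (@spanned_map _ _ (basis l) _ (fun y => M b (m b) * y)).
- by move=> y z ->.
- by move=> y z; rewrite mulrDr.
- by move=> d y; rewrite scalerAr.
- by move=> m'; rewrite -basis_cons_set_mode //; apply: spanned_gen.
- by apply: IH => //; move: al; rewrite inE eq_sym (negPf ab).
Qed.

End Modes.

End IdealCongruence.

Arguments mode_basis {K A} k P D W z.

(** * The Jordan-Wigner representation *)

Section Action.
Variables (K : fieldType) (q : K) (n k : nat).

(** The boolean is the occupation of a mode; translation of the residue by 1 is the action of [t],
    with [t^(2k) = 1]. *)
Definition state := {ffun 'I_n -> bool * 'Z_(k.*2)}.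
Implicit Types (F G : state -> K) (s : state) (a b : 'I_n) (w : word n).
Implicit Types (f g : FA K n).

Definition upd s a z : state := [ffun b => if b == a then z else s b].

Lemma upd_eq s a z : upd s a z a = z.
Proof. by rewrite ffunE eqxx. Qed.

Lemma upd_neq s a b z : b != a -> upd s a z b = s b.
Proof. by move=> /negPf ba; rewrite ffunE ba. Qed.

Lemma upd_upd s a z t : upd (upd s a z) a t = upd s a t.
Proof. by apply/ffunP => b; rewrite !ffunE; case: eqP. Qed.

Lemma upd_id s a z : z = s a -> upd s a z = s.
Proof. by move=> ->; apply/ffunP => b; rewrite !ffunE; case: eqP => // ->. Qed.

Lemma updC s a b z t : a != b -> upd (upd s a z) b t = upd (upd s b t) a z.
Proof.
move=> ab; apply/ffunP => c; rewrite !ffunE; case: (eqVneq c b) => // ->.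
by rewrite eq_sym (negPf ab).
Qed.

(** The parity of the occupied modes before [a]: the sign that makes [psi] and [psi^*] of different
    modes anticommute. *)
Definition jw a s : K := \prod_(b < n | (b < a)%N) (-1) ^+ (s b).1.

Lemma jw_sqr a s : jw a s * jw a s = 1.
Proof.
rewrite -big_split big1 //= => b _.
by rewrite -expr2 sqrr_sign.
Qed.

Lemma jw_neq0 a s : jw a s != 0.
Proof.
apply/eqP => j0; have /eqP := jw_sqr a s.
by rewrite j0 mul0r eq_sym oner_eq0.
Qed.

Lemma jw_upd_same a b s z :
  (b < a)%N ==> (z.1 == (s b).1) -> jw a (upd s b z) = jw a s.
Proof.
move=> zb; apply: eq_bigr => c ca; rewrite ffunE; case: eqP => // cb.
by move: zb; rewrite -cb ca => /eqP ->.
Qed.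

Lemma jw_upd_flip a b s z : (b < a)%N -> z.1 = ~~ (s b).1 ->
  jw a (upd s b z) = - jw a s.
Proof.
move=> ba zb; rewrite /jw (bigD1 b) //= [in RHS](bigD1 b) //= upd_eq zb -mulNr.
congr (_ * _); first by case: (s b).1; rewrite ?opprK.
by apply: eq_bigr => c /andP[_ cb]; rewrite upd_neq.
Qed.

(** Matrices act on functions as on column vectors: [E_ij] gives row [i] the value in column [j]. So
    [psi_a] reads [F] where mode [a] is empty and vanishes there itself. *)
Definition gact (x : gen n) F s : K :=
  match x with
  | inl (inl (inl a)) =>
      if (s a).1 then jw a s * F (upd s a (false, (s a).2)) else 0
  | inl (inl (inr a)) =>
      if (s a).1 then 0 else jw a s * F (upd s a (true, (s a).2 + k%:R))
  | inl (inr a) =>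
      (if (s a).1 then 1 else q^-1) * F (upd s a ((s a).1, (s a).2 + 1))
  | inr a => (if (s a).1 then 1 else q) * F (upd s a ((s a).1, (s a).2 - 1))
  end.

Definition wact w F : state -> K := foldr gact F w.

Definition act f F s : K := mmap idfun (fun w => wact w F s) f.

Lemma gact_ext x F G : F =1 G -> gact x F =1 gact x G.
Proof. by move=> FG s; case: x => [[[a|a]|a]|a] /=; rewrite ?FG. Qed.

Lemma gactD x F G s : gact x (fun t => F t + G t) s = gact x F s + gact x G s.
Proof. by case: x => [[[a|a]|a]|a] /=; case: ifP; rewrite ?addr0 ?mulrDr. Qed.

Lemma gactZ x c F s : gact x (fun t => c * F t) s = c * gact x F s.
Proof. by case: x => [[[a|a]|a]|a] /=; case: ifP; rewrite ?mulr0 // mulrCA. Qed.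

Lemma wact_ext w F G : F =1 G -> wact w F =1 wact w G.
Proof. by move=> FG; elim: w => //= x w IH s; apply: gact_ext. Qed.

Lemma wactD w F G s : wact w (fun t => F t + G t) s = wact w F s + wact w G s.
Proof.
elim: w s => //= x w IH s.
by rewrite (gact_ext _ IH) gactD.
Qed.

Lemma wactZ w c F s : wact w (fun t => c * F t) s = c * wact w F s.
Proof.
elim: w s => //= x w IH s.
by rewrite (gact_ext _ IH) gactZ.
Qed.

Lemma wact0 w s : wact w (fun=> 0) s = 0.
Proof.
rewrite -[RHS](mul0r (wact w (fun=> 0) s)) -wactZ.
by apply: wact_ext => t; rewrite mul0r.
Qed.

Lemma wact_sum (I : Type) (r : seq I) w (c : I -> K) (G : I -> state -> K) s :
  wact w (fun t => \sum_(i <- r) c i * G i t) s =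
  \sum_(i <- r) c i * wact w (G i) s.
Proof.
elim: r => [|i r IH].
  by rewrite big_nil -[RHS](wact0 w s); apply: wact_ext => t; rewrite big_nil.
rewrite big_cons -IH -wactZ -wactD.
by apply: wact_ext => t; rewrite big_cons.
Qed.

Lemma actE f F s : act f F s = \sum_(w <- msupp f) f@_w * wact w F s.
Proof. exact: mmapE. Qed.

Lemma act_scaleU c w F s : act << c *g w >> F s = c * wact w F s.
Proof. exact: mmapU. Qed.

Lemma actU w F s : act << w >> F s = wact w F s.
Proof. by rewrite act_scaleU mul1r. Qed.

Lemma act_ext f F G : F =1 G -> act f F =1 act f G.
Proof.
by move=> FG s; rewrite !actE; apply: eq_bigr => w _; rewrite (wact_ext w FG).
Qed.

Lemma act0 F s : act 0 F s = 0.
Proof. exact: mmap0. Qed.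

Lemma actD f g F s : act (f + g) F s = act f F s + act g F s.
Proof. exact: mmapD. Qed.

Lemma actN f F s : act (- f) F s = - act f F s.
Proof. exact: mmapN. Qed.

Lemma act_sum (I : Type) (r : seq I) (f : I -> FA K n) F s :
  act (\sum_(i <- r) f i) F s = \sum_(i <- r) act (f i) F s.
Proof. exact: (raddf_sum (mmap idfun (fun w => wact w F s))). Qed.

Lemma actM f g F s : act (f * g) F s = act f (act g F) s.
Proof.
rewrite malgME act_sum [RHS]actE; apply: eq_bigr => u _.
rewrite act_sum (wact_ext u (actE g F)) wact_sum mulr_sumr.
apply: eq_bigr => v _; rewrite act_scaleU -mulrA; congr (_ * (_ * _)).
by rewrite /wact foldr_cat.
Qed.

Lemma act_fun0 f s : act f (fun=> 0) s = 0.
Proof. by rewrite actE big1 // => w _; rewrite wact0 mulr0. Qed.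

Lemma actZ c f F s : act (c *: f) F s = c * act f F s.
Proof. by rewrite -mul_malgC actM act_scaleU. Qed.

Lemma act1 F s : act 1 F s = F s.
Proof. exact: actU. Qed.

Lemma actX x F s : act (X K x) F s = gact x F s.
Proof. exact: actU. Qed.

Lemma act_psi a F s : act (Psi K a) F s =
  if (s a).1 then jw a s * F (upd s a (false, (s a).2)) else 0.
Proof. exact: actX. Qed.

Lemma act_psis a F s : act (PsiS K a) F s =
  if (s a).1 then 0 else jw a s * F (upd s a (true, (s a).2 + k%:R)).
Proof. exact: actX. Qed.

Lemma act_om a F s : act (Om K a) F s =
  (if (s a).1 then 1 else q^-1) * F (upd s a ((s a).1, (s a).2 + 1)).
Proof. exact: actX. Qed.

Lemma act_omi a F s : act (OmI K a) F s =
  (if (s a).1 then 1 else q) * F (upd s a ((s a).1, (s a).2 - 1)).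
Proof. exact: actX. Qed.

Lemma act_omX a v F s : act (Om K a ^+ v) F s =
  (if (s a).1 then 1 else q^-1) ^+ v * F (upd s a ((s a).1, (s a).2 + v%:R)).
Proof.
elim: v s => [|v IH] s.
  by rewrite act1 mul1r upd_id // addr0 -surjective_pairing.
by rewrite exprS actM act_om IH upd_eq upd_upd /= mulrA -exprS -addrA -mulrS.
Qed.

Lemma act_omiX a v F s : act (OmI K a ^+ v) F s =
  (if (s a).1 then 1 else q) ^+ v * F (upd s a ((s a).1, (s a).2 - v%:R)).
Proof.
elim: v s => [|v IH] s.
  by rewrite act1 mul1r upd_id // subr0 -surjective_pairing.
rewrite exprS actM act_omi IH upd_eq upd_upd /= mulrA -exprS.
by rewrite -addrA -opprD -mulrS.
Qed.

(** * The defining relations hold in the representation *)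

Hypothesis q0 : q != 0.
Hypothesis k0 : (0 < k)%N.

Let k2_gt1 : (1 < k.*2)%N.
Proof. by rewrite -addnn; case: k k0 => // j _; rewrite addnS. Qed.

Lemma natr_Z2k_inj (i j : 'I_(k.*2)) : i%:R = j%:R :> 'Z_(k.*2) -> i = j.
Proof.
move=> /(congr1 val); rewrite /= !val_Zp_nat // !modn_small //.
exact: val_inj.
Qed.

(** Since [2k = 0], the powers [omega^k] and [omega^(-k)] shift the residue equally, as the two
    mixed relations require. *)
Lemma oppr_natk : - k%:R = k%:R :> 'Z_(k.*2).
Proof.
apply/eqP; rewrite eq_sym -addr_eq0 -natrD addnn; apply/eqP/val_inj.
by rewrite /= val_Zp_nat // modnn.
Qed.

(* The relations are evaluated by applying these congruence lemmas rather than by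
   rewriting with [actD] and [actM]: rewriting compares distinct elements of the
   free algebra up to conversion, which does not terminate in practice. *)
Let actDE f g F s u v :
  act f F s = u -> act g F s = v -> act (f + g) F s = u + v.
Proof. by move=> <- <-; rewrite actD. Qed.

Let actBE f g F s u v :
  act f F s = u -> act g F s = v -> act (f - g) F s = u - v.
Proof. by move=> <- <-; rewrite actD actN. Qed.

Let actZE c f F s u : act f F s = u -> act (c *: f) F s = c * u.
Proof. by move=> <-; rewrite actZ. Qed.

Let actXX x y F s : act (X K x * X K y) F s = gact x (gact y F) s.
Proof. by rewrite actM actX; apply: gact_ext => t; rewrite actX. Qed.

Lemma jw_jw_upd a s z : jw a s * jw a (upd s a z) = 1.
Proof. by rewrite jw_upd_same ?jw_sqr // ltnn. Qed.

(** The earlier mode counts in the sign of the later one and not conversely, so flipping both modes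
    in the two orders yields opposite signs. *)
Lemma jw_anticomm a b s z t : a != b -> z.1 = ~~ (s a).1 -> t.1 = ~~ (s b).1 ->
  jw a s * jw b (upd s a z) + jw b s * jw a (upd s b t) = 0.
Proof.
move=> ab za tb; move: ab; rewrite neq_ltn => /orP[ab|ab].
  rewrite (jw_upd_flip ab) // jw_upd_same; last by rewrite ltnNge (ltnW ab).
  by rewrite mulrN mulrC addNr.
rewrite [jw a (upd _ _ _)](jw_upd_flip ab) // jw_upd_same; last first.
  by rewrite ltnNge (ltnW ab).
by rewrite mulrN mulrC subrr.
Qed.

(** For equal modes each relation is a 2x2 matrix identity. For different modes the updates commute,
    and the signs are unaffected by [omega] or cancel by [jw_anticomm]. *)
Lemma act_cl_rel x F s : cl_rel q k x -> act x F s = 0.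
Proof.
case; [|case; [|case; [|case; [|case; [|case; [|case; [|case; [|case]]]]]]]].
- move=> [a [b ->]].
  apply: (etrans (actBE (actXX _ _ _ _) (actXX _ _ _ _))) => /=.
  have [->|ab] := eqVneq a b; first by rewrite subrr.
  have ba : b != a by rewrite eq_sym.
  by rewrite !upd_neq // updC // mulrCA subrr.
- move=> [a ->]; apply: (etrans (actBE (actXX _ _ _ _) (act1 _ _))) => /=.
  rewrite upd_eq upd_upd /= addrK -surjective_pairing upd_id // mulrA.
  by case: (s a).1; rewrite ?mulVf // ?mulr1 ?mul1r subrr.
- move=> [a ->]; apply: (etrans (actBE (actXX _ _ _ _) (act1 _ _))) => /=.
  rewrite upd_eq upd_upd /= subrK -surjective_pairing upd_id // mulrA.
  by case: (s a).1; rewrite ?mulfV // ?mulr1 ?mul1r subrr.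
- move=> [a [b ->]].
  apply: (etrans (actBE (actXX _ _ _ _) (actZE _ (actXX _ _ _ _)))) => /=.
  have [<-|ab] := eqVneq a b.
    rewrite !upd_eq !upd_upd /=; case: ifP => _; last by rewrite !mulr0 subrr.
    by rewrite mul1r mulrCA mulVKf // jw_upd_same ?subrr // ltnn.
  have ba : b != a by rewrite eq_sym.
  rewrite !upd_neq // mul1r; case: (s b).1; last by rewrite mulr0 subrr.
  by rewrite updC // mulrCA jw_upd_same ?subrr //= eqxx implybT.
- move=> [a [b ->]].
  apply: (etrans (actBE (actXX _ _ _ _) (actZE _ (actXX _ _ _ _)))) => /=.
  have [<-|ab] := eqVneq a b.
    rewrite !upd_eq !upd_upd /=; case: ifP => _; first by rewrite !mulr0 subrr.
    by rewrite mul1r addrAC jw_upd_same ?subrr // ltnn.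
  have ba : b != a by rewrite eq_sym.
  rewrite !upd_neq // mul1r; case: (s b).1; first by rewrite mulr0 subrr.
  by rewrite updC // mulrCA jw_upd_same ?subrr //= eqxx implybT.
- move=> [a [b ->]].
  apply: (etrans (actDE (actXX _ _ _ _) (actXX _ _ _ _))) => /=.
  have [<-|ab] := eqVneq a b; first by rewrite upd_eq mulr0 if_same addr0.
  have ba : b != a by rewrite eq_sym.
  rewrite !upd_neq //.
  case: ifP => sa; case: ifP => sb; rewrite ?mulr0 ?addr0 //.
  rewrite updC // mulrA [X in _ + X]mulrA -mulrDl.
  by rewrite jw_anticomm ?sa ?sb // mul0r.
- move=> [a [b ->]].
  apply: (etrans (actDE (actXX _ _ _ _) (actXX _ _ _ _))) => /=.
  have [<-|ab] := eqVneq a b; first by rewrite upd_eq mulr0 if_same addr0.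
  have ba : b != a by rewrite eq_sym.
  rewrite !upd_neq //.
  case: ifP => sa; case: ifP => sb; rewrite ?mulr0 ?addr0 //.
  rewrite updC // mulrA [X in _ + X]mulrA -mulrDl.
  by rewrite jw_anticomm ?sa ?sb // mul0r.
- move=> [a ->].
  apply: (etrans (actBE (actDE (actXX _ _ _ _) (actZE _ (actXX _ _ _ _)))
                        (act_omiX _ _ _ _))) => /=.
  rewrite !upd_eq !upd_upd /= oppr_natk.
  by case: ifP => sa; rewrite mulrA jw_jw_upd mul1r ?mulr0 ?addr0 ?add0r
    ?expr1n ?mul1r subrr.
- move=> [a ->].
  apply: (etrans (actBE (actDE (actXX _ _ _ _) (actZE _ (actXX _ _ _ _)))
                        (act_omX _ _ _ _))) => /=.
  rewrite !upd_eq !upd_upd /=.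
  by case: ifP => sa; rewrite mulrA jw_jw_upd mul1r ?mulr0 ?addr0 ?add0r
    ?expr1n ?mul1r ?exprVn subrr.
- move=> [a [b [ab ->]]].
  apply: (etrans (actDE (actXX _ _ _ _) (actXX _ _ _ _))) => /=.
  have ba : b != a by rewrite eq_sym.
  rewrite !upd_neq //.
  case: ifP => sa; case: ifP => sb; rewrite ?mulr0 ?addr0 //.
  rewrite updC // mulrA [X in _ + X]mulrA -mulrDl.
  by rewrite jw_anticomm ?sa ?sb // mul0r.
Qed.

Lemma act_cl_ideal x F s : cl_ideal q k x -> act x F s = 0.
Proof.
move=> Ix; elim: Ix F s => [F s|y l r Sy F s|y z _ IHy _ IHz F s].
- exact: act0.
- rewrite !actM -(act_fun0 l s); apply: act_ext => t.
  exact: act_cl_rel.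
- by rewrite actD IHy IHz addr0.
Qed.

(** * Monomials as partial permutations of the states *)

Let act_psiX (p : bool) a F s : act (Psi K a ^+ p) F s =
  if p then if (s a).1 then jw a s * F (upd s a (false, (s a).2)) else 0
  else F s.
Proof. by case: p; [apply: act_psi|apply: act1]. Qed.

Let act_psisX (d : bool) a F s : act (PsiS K a ^+ d) F s =
  if d then if (s a).1 then 0 else jw a s * F (upd s a (true, (s a).2 + k%:R))
  else F s.
Proof. by case: d; [apply: act_psis|apply: act1]. Qed.

(** Occupations with nonzero coefficient: [psi] needs an occupied mode and passes to the empty one,
    where [psi^*] always acts; [psi^*] alone needs an empty mode. *)
Definition mode_dom (z : bool * bool * 'I_(k.*2)) (e : bool) : bool :=
  if z.1.1 then e else z.1.2 ==> ~~ e.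

Definition mode_target (z : bool * bool * 'I_(k.*2)) (y : bool * 'Z_(k.*2)) :
    bool * 'Z_(k.*2) :=
  (if z.1.2 then true else y.1 && ~~ z.1.1,
   y.2 + (if z.1.2 then k%:R else 0) + z.2%:R).

(** Of the coefficient only its vanishing is recorded, as independence rests on the supports
    alone. *)
Lemma act_mode_monomial a z s : exists c : K,
  (c != 0) = mode_dom z (s a).1 /\
  forall F, act (Psi K a ^+ z.1.1 * PsiS K a ^+ z.1.2 * Om K a ^+ z.2) F s =
            c * F (upd s a (mode_target z (s a))).
Proof.
case: z => [[p d] v]; rewrite /mode_dom /mode_target.
pose psi G (t : state) := if p then if (t a).1
    then jw a t * G (upd t a (false, (t a).2)) else 0 else G t : K.
pose psis G (t : state) := if d then if (t a).1 then 0
    else jw a t * G (upd t a (true, (t a).2 + k%:R)) else G t : K.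
pose om G (t : state) := (if (t a).1 then 1 else q^-1) ^+ v *
  G (upd t a ((t a).1, (t a).2 + v%:R)) : K.
have actPDW F : act (Psi K a ^+ p * PsiS K a ^+ d * Om K a ^+ v) F s =
                psi (psis (om F)) s.
  rewrite actM actM act_psiX.
  have E t :
    act (PsiS K a ^+ d) (act (Om K a ^+ v) F) t = psis (om F) t.
    rewrite act_psisX /psis /om.
    by case: ifP => _; [case: ifP => // _; congr (_ * _)|]; apply: act_omX.
  by rewrite /psi !E.
case Es: (s a) => [e j] /=.
(* Three of the eight cases lie outside the domain and have coefficient 0; in the others unification
   reads the coefficient off the computed action. *)
case: p d e @psi @psis @om Es actPDW => [] [] [] psi psis om Es actPDW; do ?[
  by exists 0; split=> [|F]; rewrite ?eqxx // actPDW /psi /psis Es /= ?mul0r];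
  eexists; (split; last by move=> F; rewrite actPDW /psi /psis /om ?upd_eq ?Es /=
    ?upd_eq /= ?upd_upd ?mulrA ?addr0; reflexivity);
  by rewrite !(mulf_eq0, expf_eq0, negb_or, jw_neq0, oner_eq0, invr_eq0,
               negPf q0, andbF).
Qed.

Definition target (l : seq 'I_n) (m : clidx n k) s : state :=
  [ffun a => if a \in l then mode_target (m a) (s a) else s a].

Lemma act_prod (l : seq 'I_n) (m : clidx n k) s : uniq l -> exists c : K,
  (c != 0) = all (fun a => mode_dom (m a) (s a).1) l /\
  forall F, act (\prod_(a <- l) (Psi K a ^+ (m a).1.1 * PsiS K a ^+ (m a).1.2
                                 * Om K a ^+ (m a).2)) F s
            = c * F (target l m s).
Proof.
elim: l s => [|a l IH] s /= => [_|/andP[al ul]].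
  exists 1; split=> [|F]; first by rewrite oner_eq0.
  rewrite big_nil act1 mul1r; congr F.
  by apply/ffunP => b; rewrite ffunE.
have [c [c0 cF]] := act_mode_monomial a (m a) s.
have [d [d0 dF]] := IH (upd s a (mode_target (m a) (s a))) ul.
exists (c * d); split=> [|F].
  rewrite mulf_eq0 negb_or c0 d0; congr (_ && _).
  apply: eq_in_all => b bl; rewrite upd_neq //.
  by apply: contraNneq al => <-.
rewrite big_cons actM cF dF mulrA; congr (_ * F _).
apply/ffunP => b; rewrite !ffunE in_cons; case: eqVneq => [->|] //=.
by rewrite (negPf al).
Qed.

(** * Linear independence *)

Definition paired_modes (m : clidx n k) : {set 'I_n} :=
  [set a | (m a).1.1 && (m a).1.2].

(* [mode_dom] and [mode_target] describe the partial permutation of the states of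
   one mode induced by a monomial; the second alternative is the coincidence of
   [psi psi^* omega^v] with a power of [omega] on the occupied state. *)
Lemma mode_target_eq z z' :
  mode_dom z' z.1.1 -> mode_target z' (z.1.1, 0) = mode_target z (z.1.1, 0) ->
  z' = z \/ ~~ (z'.1.1 && z'.1.2) && (z.1.1 && z.1.2).
Proof.
case: z z' => [[p d] v] [[p' d'] v']; rewrite /mode_dom /mode_target /=.
move=> dom E; have := congr1 fst E; have := congr1 snd E; move: dom => {E} /=.
by case: p p' d d' => [] [] [] [] //= _ E _; auto;
  rewrite (natr_Z2k_inj (addrI _ E)); left.
Qed.

Lemma clmon_free (c : clidx n k -> K) :
  cl_ideal q k (\sum_(m : clidx n k) c m *: clmon K m) -> forall m, c m = 0.
Proof.
move=> Ic m; elim: {m}_.+1 {-2}m (ltnSn #|paired_modes m|) => // N IHN m.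
rewrite ltnS => mN.
(* Mode [a] is occupied exactly when [psi_a] occurs in [m], so [m] acts nontrivially at [s]. Below,
   [F] is the indicator of its target, which isolates the monomials sending [s] there. *)
pose s : state := [ffun a => ((m a).1.1, 0)].
have [d [d0 dF]] := act_prod m s (index_enum_uniq _).
set l := index_enum _ in d0 dF.
pose F t : K := (t == target l m s)%:R.
have := act_cl_ideal F s Ic; rewrite act_sum (bigD1 m) //= big1 => [|m' m'm].
  rewrite addr0 actZ [act _ _ _]dF /F eqxx mulr1 => /eqP; rewrite mulf_eq0.
  suff /negPf -> : d != 0 by rewrite orbF => /eqP.
  rewrite d0; apply/allP => a _; rewrite ffunE /mode_dom /=.
  by case: (m a) => [[[] []] v].
have [d' [d'0 d'F]] := act_prod m' s (index_enum_uniq _).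
rewrite actZ [act _ _ _]d'F -/l /F; case: eqP => [tt|_]; last by rewrite !mulr0.
have [->|d'n0] := eqVneq d' 0; first by rewrite mul0r mulr0.
rewrite d'n0 in d'0; move/esym/allP: d'0 => domm'.
(* Such an [m'] agrees with [m] except at modes paired in [m] and not in [m']; as [m' != m], it has
   fewer paired modes and [c m' = 0] by induction. *)
suff lt_exc : (#|paired_modes m'| < #|paired_modes m|)%N.
  by rewrite (IHN m') ?mul0r // (leq_trans lt_exc).
have modes a : m' a = m a \/ (a \notin paired_modes m') && (a \in paired_modes m).
  rewrite !inE; apply: mode_target_eq.
    by have := domm' a (mem_index_enum a); rewrite ffunE.
  by move/ffunP/(_ a): tt; rewrite !ffunE mem_index_enum.
apply: proper_card; apply/properP; split.
  apply/subsetP => a m'a; case: (modes a) => [ma|/andP[]//].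
  by move: m'a; rewrite !inE ma.
have [a ma] : exists a, m' a != m a.
  apply/existsP; rewrite -negb_forall; apply: contra m'm => /forallP mm.
  by apply/eqP/ffunP => a; apply/eqP.
exists a; case: (modes a) => [/eqP|/andP[]//]; by rewrite (negPf ma).
Qed.

End Action.

(** * Spanning *)

Section FreeAlgebra.
Context {K : fieldType} {n : nat}.

Lemma malg_mulUU (u v : word n) :
  (<< u >> : FA K n) * << v >> = << (u ++ v : word n) >>.
Proof. by rewrite malgM_def fgmulUU mulr1. Qed.

Lemma malg_scaleU (c : K) (w : word n) : << c *g w >> = c *: (<< w >> : FA K n).
Proof. by rewrite -mul_malgC malgM_def fgmulUU mulr1. Qed.

(** Constants are central, because [K] is commutative and the empty word is neutral on both sides.
    This makes [FA] an algebra over [K]. *)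
Lemma FA_scalerAr (c : K) (x y : FA K n) : c *: (x * y) = x * (c *: y).
Proof.
rewrite -!mul_malgC !mulrA; congr (_ * y); rewrite !malgM_def fgmulUg fgmulgU.
by apply: eq_bigr => w _; rewrite mul1m mulm1 mulrC.
Qed.

End FreeAlgebra.

HB.instance Definition _ (K : fieldType) n := GRing.Lalgebra.on (FA K n).
HB.instance Definition _ (K : fieldType) n :=
  GRing.Lalgebra_isAlgebra.Build K (FA K n) FA_scalerAr.

#[local] Hint Resolve cong_refl : core.
#[local] Existing Instances cong_equiv cong_add cong_opp cong_mul cong_scale.
#[local] Existing Instance spanned_cong.

(** * Stability of the span under the generators *)

Section Spanning.
Variables (K : fieldType) (q : K) (n k : nat).
Hypothesis two0 : (2%:R : K) != 0.
Hypothesis q0 : q != 0.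
Hypothesis k0 : (0 < k)%N.

Let S : FA K n -> Prop := @cl_rel K q n k.
Let P (a : 'I_n) : FA K n := Psi K a.
Let D (a : 'I_n) : FA K n := PsiS K a.
Let W (a : 'I_n) : FA K n := Om K a.
Let V (a : 'I_n) : FA K n := OmI K a.

Let om_om a b : cong S (W a * W b) (W b * W a).
Proof. by apply: cong_relB; left; exists a, b. Qed.

Let om_omi a : cong S (W a * V a) 1.
Proof. by apply: cong_relB; do 1!right; left; exists a. Qed.

Let omi_om a : cong S (V a * W a) 1.
Proof. by apply: cong_relB; do 2!right; left; exists a. Qed.

Let om_psi a b : cong S (W a * P b) ((if a == b then q else 1) *: (P b * W a)).
Proof. by apply: cong_relB; do 3!right; left; exists a, b. Qed.

Let om_psis a b :
  cong S (W a * D b) ((if a == b then q^-1 else 1) *: (D b * W a)).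
Proof. by apply: cong_relB; do 4!right; left; exists a, b. Qed.

Let psi_psi a b : cong S (P a * P b) (- (P b * P a)).
Proof. by apply: cong_relD; do 5!right; left; exists a, b. Qed.

Let psis_psis a b : cong S (D a * D b) (- (D b * D a)).
Proof. by apply: cong_relD; do 6!right; left; exists a, b. Qed.

Let psi_psis_omi a :
  cong S (P a * D a + q ^+ k *: (D a * P a)) (V a ^+ k).
Proof. by apply: cong_relB; do 7!right; left; exists a. Qed.

Let psi_psis_om a :
  cong S (P a * D a + q ^- k *: (D a * P a)) (W a ^+ k).
Proof. by apply: cong_relB; do 8!right; left; exists a. Qed.

Let psi_psis a b : a != b -> cong S (P a * D b) (- (D b * P a)).
Proof. by move=> ab; apply: cong_relD; do 9!right; exists a, b. Qed.

(** Here the characteristic matters: anticommutation of a generator with itself gives only [2 x = 0]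
    for its square [x]. *)
Let cong_oppr_eq0 (x : FA K n) : cong S x (- x) -> cong S x 0.
Proof.
move=> xN; apply: (cong_scaleI two0).
by rewrite scaler_nat mulr2n {2}xN subrr scaler0.
Qed.

Let om_psi1 a : cong S (W a * P a) (q *: (P a * W a)).
Proof. by have := om_psi a a; rewrite eqxx. Qed.

Let om_psis1 a : cong S (W a * D a) (q^-1 *: (D a * W a)).
Proof. by have := om_psis a a; rewrite eqxx. Qed.

Let psi_sqr a : cong S (P a * P a) 0.
Proof. exact/cong_oppr_eq0/psi_psi. Qed.

Let psis_sqr a : cong S (D a * D a) 0.
Proof. exact/cong_oppr_eq0/psis_psis. Qed.

Let om_psiC a b : a != b -> cong S (W a * P b) (P b * W a).
Proof. by move=> /negPf ab; have := om_psi a b; rewrite ab scale1r. Qed.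

Let om_psisC a b : a != b -> cong S (W a * D b) (D b * W a).
Proof. by move=> /negPf ab; have := om_psis a b; rewrite ab scale1r. Qed.

Let B (m : clidx n k) : FA K n := clmon K m.

Let stable (x : FA K n) : Prop :=
  forall y, spanned S B y -> spanned S B (x * y).

Let stable_mode a x :
  (forall b, b != a ->
     [/\ quasi_comm S x (P b), quasi_comm S x (D b) & quasi_comm S x (W b)]) ->
  (forall z, spanned S (mode_basis k (P a) (D a) (W a))
     (x * mode_basis k (P a) (D a) (W a) z)) ->
  stable x.
Proof.
move=> xC xM y; apply: (@spanned_map _ _ S _ _ _ _ (fun y => x * y)).
- by move=> u v ->.
- by move=> u v; rewrite mulrDr.
- by move=> c u; rewrite scalerAr.
move=> m; apply: (@spanned_mul_basis _ _ S n k P D W a) => //.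
- move=> b z /xC[xP xD xW]; exact: quasi_comm_mode_basis.
- exact: index_enum_uniq.
- exact: mem_index_enum.
Qed.

Let stable_psi a : stable (P a).
Proof.
apply: (@stable_mode a) => [b ba|z]; last first.
  exact: (psi_mode_basis q0 k0 (omi_om a) (om_psis1 a) (psi_sqr a) (psis_sqr a)
    (psi_psis_omi a) (psi_psis_om a)).
split.
- exact/quasi_comm_congN/psi_psi.
- by apply/quasi_comm_congN/psi_psis; rewrite eq_sym.
- exact/quasi_commC_cong/om_psiC.
Qed.

Let stable_psis a : stable (D a).
Proof.
apply: (@stable_mode a) => [b ba|z]; last first.
  exact: (psis_mode_basis q0 k0 (omi_om a) (om_psis1 a) (psi_sqr a) (psis_sqr a)
    (psi_psis_omi a) (psi_psis_om a)).
split.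
- exact/quasi_commC_congN/psi_psis.
- exact/quasi_comm_congN/psis_psis.
- exact/quasi_commC_cong/om_psisC.
Qed.

Let stable_om a : stable (W a).
Proof.
apply: (@stable_mode a) => [b ba|z]; last first.
  exact: (om_mode_basis q0 k0 (omi_om a) (om_psi1 a) (om_psis1 a) (psi_sqr a) (psis_sqr a)
    (psi_psis_omi a) (psi_psis_om a)).
split.
- by apply/quasi_comm_cong/om_psiC; rewrite eq_sym.
- by apply/quasi_comm_cong/om_psisC; rewrite eq_sym.
- exact/quasi_comm_cong/om_om.
Qed.

Let stableM x y : stable x -> stable y -> stable (x * y).
Proof. by move=> sx sy z /sy/sx; rewrite mulrA. Qed.

Let stableX x j : stable x -> stable (x ^+ j).
Proof.
move=> sx; elim: j => [|j IH]; last by rewrite exprS; apply: stableM.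
by move=> y; rewrite mul1r.
Qed.

(** None of the relations moves [V a] past [P b] or [D b]; instead [V a] is replaced by its
    expression in the other three generators of mode [a]. *)
Let stable_omi a : stable (V a).
Proof.
have PDW : stable (P a * D a * W a ^+ k.-1).
  exact: (stableM (stableM (stable_psi a) (stable_psis a))
            (stableX k.-1 (stable_om a))).
move=> y By.
rewrite (om_inv q0 k0 (om_omi a) (omi_om a) (psi_psis_omi a) (psi_psis_om a)).
rewrite mulrDl -scalerAl mulrBl; apply: spannedD; first exact: PDW.
apply/spannedZ/spannedB; last exact: PDW.
exact: (stableX k.*2.-1 (stable_om a)).
Qed.

(** Words span the free algebra and arise by left multiplications from the empty word, the monomial
    with all exponents 0. *)
Lemma spanned_clmon f : spanned S B f.
Proof.
rewrite (monalgE f); apply: spanned_sum => w; rewrite malg_scaleU.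
apply: spannedZ; elim: w {f} => [|g w IH].
  have k20 : (0 < k.*2)%N by rewrite double_gt0.
  pose z : clidx n k := [ffun=> (false, false, Ordinal k20)].
  suff <- : B z = << [::] >> by apply: spanned_gen.
  by rewrite /B /clmon big1 // => a _; rewrite ffunE /= !mulr1.
have -> : << g :: w >> = X K g * << w >> by rewrite malg_mulUU.
suff : stable (X K g) by apply.
case: g => [[[]|]|] a; [exact: stable_psi|exact: stable_psis|exact: stable_om|].
exact: stable_omi.
Qed.

End Spanning.

Theorem theorem3p4 (K : fieldType) (q : K) (n k : nat) :
  (2%:R : K) != 0 -> q != 0 -> (0 < n)%N -> (0 < k)%N ->
  (* spanning: every element of Cl_q(n,k) is a K-linear combination of B *)
  (forall f : FA K n, exists c : clidx n k -> K,
     cl_ideal q k (f - \sum_(m : clidx n k) c m *: clmon K m)) /\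
  (* linear independence of B in Cl_q(n,k) *)
  (forall c : clidx n k -> K,
     cl_ideal q k (\sum_(m : clidx n k) c m *: clmon K m) -> forall m, c m = 0).
Proof.
move=> two0 q0 _ k0; split=> [f|c Ic m].
  exact: (spanned_clmon two0 q0 k0 f).
exact: (clmon_free q0 k0 Ic).
Qed.
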